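(* Suppose that the set $\Xi$ is finite and $\Xi\cap\mathcal{B}=\emptyset$ (with $\mathcal{B}$ as in the context), and that the following conditions hold: (a) the graph of the power network is acyclic, and (b) the energy costs are spatially homogeneous, i.e. $\alpha^j=\alpha$ and $\beta^j=\beta$ for all $j=1,\dots,m$ for some $\alpha\ge\beta\ge 0$. Then, for each $i=1,\dots,m$, $$\lambda^i(\xi)\in\{\alpha,\beta\}\quad\text{for all }\xi\in\Xi,$$ and $$\mathsf{LMV}^i=\frac12\,\mathbb{E}\big[\mathsf{TV}(\lambda^i)\big]+\frac12\,\mathbb{E}\big[\lambda^i_{N-1}-\lambda^i_0\big].$$ Further, $\mathsf{LMV}^i$ equals $(\alpha-\beta)$ times the expected number of periods $k$ for which $\lambda^i_k=\beta$ and $\lambda^i_{k+1}=\alpha$.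
   Context: Network. A power network is a connected undirected graph on $m$ nodes $1,\dots,m$ with $\ell$ edges (transmission lines). The line joining $i$ and $j$ has susceptance $y^{ij}=y^{ji}$ (with $y^{ij}=0$ if $i\ne j$ are not joined by a line), and $y^{ii}$ is the susceptance of the shunt element at node $i$. Let $Y \in \mathbb{R}^{m\times m}$ with $Y^{ij}=-y^{ij}$ for $i\ne j$ and $Y^{ii}=y^{ii}+\sum_{j\neq i} y^{ij}$. Let $B\in\mathbb{R}^{\ell\times m}$ be the weighted incidence matrix: for line $k$ joining $i$ and $j$, $B^{ki}=-B^{kj}=y^{ij}$ and $B^{kr}=0$ for $r\ne i,j$. Let $f\in\mathbb{R}_+^\ell$ be the vector of line capacities. The injection polytope is $\mathcal{P}=\{x\in\mathbb{R}^m : x=Y\theta,\ -f\le B\theta\le f \text{ for some }\theta\in\mathbb{R}^m\}$. Costs. For $x\in\mathbb{R}$, $x^+=\max\{x,0\}$. For constants $\alpha^i\ge\beta^i\ge 0$, let $g^i(v^i)=\alpha^i (v^i)^+-\beta^i(-v^i)^+$ and $g(v)=\sum_{i=1}^m g^i(v^i)$ for $v\in\mathbb{R}^m$. Net demand. $\{\xi_0,\dots,\xi_{N-1}\}$ is a random process with known joint distribution, each $\xi_k$ taking values in $\Xi\subset\mathbb{R}^m$ (no stationarity or independence is assumed). Storage and policies. For $b\in\mathbb{R}_+^m$ let $\mathcal{Z}(b)=\{z\in\mathbb{R}^m_+ : 0\le z\le b\}$. Storage states evolve as $z_{k+1}=z_k+u_k$, $k=0,\dots,N-1$, $z_0=0$.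 With information $I_k=(z_{\le k},\xi_{\le k})$, where $x_{\le k}=(x_0,\dots,x_k)$, a control policy $\pi=((\mu_0,\nu_0),\dots,(\mu_{N-1},\nu_{N-1}))$ gives $u_k=\mu_k(I_k)\in\mathbb{R}^m$, $v_k=\nu_k(I_k)\in\mathbb{R}^m$. It is admissible ($\pi\in\Pi(b)$) if $z_k+\mu_k(I_k)\in\mathcal{Z}(b)$ and $\nu_k(I_k)-\mu_k(I_k)-\xi_k\in\mathcal{P}$ almost surely for each $k=0,\dots,N-1$. Set $J^\pi(b)=\mathbb{E}\big[\sum_{k=0}^{N-1} g(\nu_k(I_k))\big]$ and $J^*(b)=\inf\{J^\pi(b):\pi\in\Pi(b)\}$. The locational marginal value of initial investment in storage capacity at node $i$ is $\mathsf{LMV}^i=-\frac{\partial J^*(b)}{\partial b^i}\big|_{b=0^+}$, where the derivative is the right-hand derivative of $J^*$ with respect to the $i$-th coordinate at $b=0$ (it exists by convexity of $J^*$). Single-period dispatch and prices. For $\xi\in\mathbb{R}^m$ let $Q(\xi)=\inf\{g(v): v\in\mathbb{R}^m,\ v-\xi\in\mathcal{P}\}$; this problem is feasible and the infimum is achieved for each $\xi$. Writing the constraint as $v-\xi=Y\theta$, $-f\le B\theta\le f$ for some $\theta\in\mathbb{R}^m$, let $\lambda(\xi)\in\mathbb{R}^m$ be the optimal Lagrange multiplier associated with the power balance constraint $v-\xi=Y\theta$ (signed so that $\lambda(\xi)$ measures the marginal cost of increasing $\xi$). Partition. Fix a full-dimensional polytope $\mathcal{K}\subset\mathbb{R}^m$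 with $\Xi\subset\mathrm{int}(\mathcal{K})$, and a polyhedral partition $\mathcal{L}=\{\mathcal{S}_1,\dots,\mathcal{S}_{|\mathcal{L}|}\}$ of $\mathcal{K}$ (a finite collection of polyhedral sets with union $\mathcal{K}$ and pairwise disjoint interiors) such that: $Q$ is affine on each $\mathcal{S}_j$; on each $\mathrm{int}(\mathcal{S}_j)$, $\lambda(\cdot)$ is nonnegative and constant and $\nabla Q=\lambda$; and $\mathcal{B}:=\bigcup_{j}\partial\mathcal{S}_j$ has zero Lebesgue measure. (Such a partition exists.) Here $\partial\mathcal{S}=\mathcal{S}\setminus\mathrm{int}(\mathcal{S})$. When $\Xi\cap\mathcal{B}=\emptyset$, $\lambda(\xi)$ is uniquely defined for all $\xi\in\Xi$. Price process. $\lambda_k^i=\lambda^i(\xi_k)$ (the $i$-th entry of $\lambda(\xi_k)$), $k=0,\dots,N-1$, and $\lambda^i=(\lambda_0^i,\dots,\lambda_{N-1}^i)$. For a scalar sequence $x=(x_0,\dots,x_{N-1})$, $\mathsf{TV}(x)=\sum_{k=0}^{N-2}|x_{k+1}-x_k|$.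
   Formalization: The shunt susceptances y^{ii} are assumed nonnegative; with shunts of mixed sign the claim fails (two nodes, one line with 0<y<2, shunts 2 and -1, α=4, β=1 give prices (1,2) on an open region). *)

(* Defs.v *)
From HB Require Import structures.
From mathcomp Require Import all_boot all_order all_algebra.
From mathcomp Require Import all_classical all_reals all_analysis.
Import Order.TTheory GRing.Theory Num.Theory.
Import numFieldNormedType.Exports.

Set Implicit Arguments.
Unset Strict Implicit.
Unset Printing Implicit Defensive.

Local Open Scope classical_set_scope.
Local Open Scope ring_scope.

(** * Power network *)

Definition joined (m l : nat) (src tgt : 'I_l -> 'I_m) : rel 'I_m :=
  [rel i j | [exists k, [set src k; tgt k]%SET == [set i; j]%SET]].

(* Line [k] joins [src k] and [tgt k]; the order of the two endpoints only
   fixes the (arbitrary) sign of row [k] of the incidence matrix. *)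
Record network (R : realType) (m l : nat) := Network {
  src : 'I_l -> 'I_m;
  tgt : 'I_l -> 'I_m;
  line_irrefl : forall k, src k != tgt k;
  line_simple : forall k k',
    [set src k; tgt k]%SET = [set src k'; tgt k']%SET -> k = k';
  susc : 'M[R]_m;  (* lines off the diagonal, shunts on the diagonal *)
  susc_sym : forall i j, susc i j = susc j i;
  susc_noline : forall i j, i != j -> ~~ joined src tgt i j -> susc i j = 0;
  (* With shunts of opposite signs, voltages common to all nodes would exchange
     energy between nodes at an arbitrary rate, and prices could leave
     {alpha, beta}.  No sign is imposed on line susceptances. *)
  shunt_ge0 : forall i, 0 <= susc i i;
  cap : 'cV[R]_l;
  cap_ge0 : forall k, 0 <= cap k 0;
  net_connected : forall i j, connect (joined src tgt) i j
}.

Section Network.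
Context {R : realType} {m l : nat}.
Variable net : network R m l.

(* [ucycle] also accepts the empty cycle and the back-and-forth traversal
   [:: i; j] of a single line, which are not graph cycles. *)
Definition acyclic_net : Prop :=
  forall c : seq 'I_m, ucycle (joined (src net) (tgt net)) c -> (size c < 3)%N.

Definition Ymx : 'M[R]_m :=
  \matrix_(i, j) (if i == j then susc net i i + \sum_(r | r != i) susc net i r
                  else - susc net i j).

Definition Bmx : 'M[R]_(l, m) :=
  \matrix_(k, r) (if r == src net k then susc net (src net k) (tgt net k)
                  else if r == tgt net k then - susc net (src net k) (tgt net k)
                  else 0).

Definition injection_polytope : set 'cV[R]_m :=
  [set x | exists th : 'cV[R]_m, x = Ymx *m th /\
     forall k, - cap net k 0 <= (Bmx *m th) k 0 <= cap net k 0].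

End Network.

(** * Costs, single-period dispatch and prices *)

Section Dispatch.
Context {R : realType} {m l : nat}.
Variables (net : network R m l) (al be : 'I_m -> R).

Definition gcost (v : 'cV[R]_m) : R :=
  \sum_i (al i * Num.max (v i 0) 0 - be i * Num.max (- v i 0) 0).

Definition dispatch (x : 'cV[R]_m) : \bar R :=
  ereal_inf [set (gcost v)%:E | v in
    [set v : 'cV[R]_m | injection_polytope net (v - x)]].

Definition dot n (x y : 'cV[R]_n) : R := \sum_i x i 0 * y i 0.

Definition lagrangian (x lam : 'cV[R]_m) (ep em : 'cV[R]_l)
    (v th : 'cV[R]_m) : R :=
  gcost v + dot lam (x + Ymx net *m th - v)
  + dot ep (Bmx net *m th - cap net) + dot em (- cap net - Bmx net *m th).

(* [lam] is the balance-constraint component of an optimal dual solution: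
   with some nonnegative multipliers of the line constraints, the dual
   function attains the optimal value. *)
Definition is_multiplier (x lam : 'cV[R]_m) : Prop :=
  exists ep em : 'cV[R]_l,
    [/\ forall k, 0 <= ep k 0, forall k, 0 <= em k 0 &
     dispatch x = ereal_inf
       [set (lagrangian x lam ep em w.1 w.2)%:E
         | w in [set: 'cV[R]_m * 'cV[R]_m]]].

End Dispatch.

(** * Polyhedral partition *)

Section Partition.
Context {R : realType} {m : nat}.

Definition polyhedron (S : set 'cV[R]_m) : Prop :=
  exists (p : nat) (A : 'M[R]_(p, m)) (c : 'cV[R]_p),
    S = [set x | forall r, (A *m x) r 0 <= c r 0].

Definition box (a b : 'cV[R]_m) : set 'cV[R]_m :=
  [set x | forall i, a i 0 <= x i 0 <= b i 0].

Definition box_volume (a b : 'cV[R]_m) : R :=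
  \prod_i Num.max (b i 0 - a i 0) 0.

(* Lebesgue outer measure on R^m, whose zero sets are the sets of zero
   Lebesgue measure. *)
Definition lebesgue_outer (A : set 'cV[R]_m) : \bar R :=
  ereal_inf [set (\sum_(0 <= k <oo) (box_volume (ab.1 k) (ab.2 k))%:E)%E
    | ab in [set ab : (nat -> 'cV[R]_m) * (nat -> 'cV[R]_m) |
        A `<=` \bigcup_k box (ab.1 k) (ab.2 k)]].

Definition partition_boundary p (S : 'I_p -> set 'cV[R]_m) : set 'cV[R]_m :=
  \bigcup_j (S j `\` (S j)°).

Record price_partition l (net : network R m l) (al be : 'I_m -> R)
    (lam : 'cV[R]_m -> 'cV[R]_m) (Xi K : set 'cV[R]_m)
    p (S : 'I_p -> set 'cV[R]_m) : Prop := PricePartition {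
  dom_polyhedron : polyhedron K;
  dom_bounded : bounded_set K;
  dom_full : K° !=set0;
  dom_demand : Xi `<=` K°;
  part_polyhedron : forall j, polyhedron (S j);
  part_cover : \bigcup_j S j = K;
  part_disjoint : forall j j', j != j' -> (S j)° `&` (S j')° = set0;
  part_affine : forall j, exists (a : 'cV[R]_m) (c : R),
    forall x, S j x -> dispatch net al be x = (dot a x + c)%:E;
  part_price_ge0 : forall j x i, (S j)° x -> 0 <= lam x i 0;
  part_price_const : forall j x y, (S j)° x -> (S j)° y -> lam x = lam y;
  part_gradient : forall j x, (S j)° x ->
    differentiable (fine \o dispatch net al be : 'cV[R]_m -> R) x /\
    forall h, 'd (fine \o dispatch net al be : 'cV[R]_m -> R) x h
              = dot (lam x) h;
  part_null : lebesgue_outer (partition_boundary S) = 0%E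
}.

End Partition.

(** * Storage control *)

(* A control law at stage [k] depends on the histories (z_0, ..., z_k) and
   (xi_0, ..., xi_k); only the stages below the horizon are ever used. *)
Definition control_law (R : realType) (m : nat) :=
  forall k : nat, k.+1.-tuple 'cV[R]_m -> k.+1.-tuple 'cV[R]_m -> 'cV[R]_m.

Record policy (R : realType) (m : nat) := Policy {
  storage_law : control_law R m;
  balance_law : control_law R m
}.

Section Storage.
Context {R : realType} {m l : nat} {d : measure_display}
  {T : measurableType d}.
Variables (net : network R m l) (al be : 'I_m -> R) (P : probability T R).
Variables (N : nat) (xi : nat -> 'I_m -> {RV P >-> R}).

Definition demand (k : nat) (w : T) : 'cV[R]_m := \col_i xi k i w.

Definition demand_hist (k : nat) (w : T) : k.+1.-tuple 'cV[R]_m :=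
  [tuple demand i w | i < k.+1].

Fixpoint storage_hist (pi : policy R m) (w : T) (k : nat) :
    k.+1.-tuple 'cV[R]_m :=
  match k with
  | 0 => [tuple 0]
  | k'.+1 =>
      let zs := storage_hist pi w k' in
      [tuple of rcons zs
        (tnth zs ord_max + storage_law pi zs (demand_hist k' w))]
  end.

Definition storage (pi : policy R m) (k : nat) (w : T) : 'cV[R]_m :=
  tnth (storage_hist pi w k) ord_max.

Definition ucontrol (pi : policy R m) (k : nat) (w : T) : 'cV[R]_m :=
  storage_law pi (storage_hist pi w k) (demand_hist k w).

Definition vcontrol (pi : policy R m) (k : nat) (w : T) : 'cV[R]_m :=
  balance_law pi (storage_hist pi w k) (demand_hist k w).

Definition storage_set (b : 'cV[R]_m) : set 'cV[R]_m :=
  [set z | forall i, 0 <= z i 0 <= b i 0].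

Definition admissible (b : 'cV[R]_m) : set (policy R m) :=
  [set pi | forall k, (k < N)%N ->
    {ae P, forall w,
      storage_set b (storage pi k w + ucontrol pi k w) /\
      injection_polytope net (vcontrol pi k w - ucontrol pi k w - demand k w)}].

Definition Jpol (pi : policy R m) : \bar R :=
  'E_P[fun w => \sum_(k < N) gcost al be (vcontrol pi k w)].

Definition Jstar (b : 'cV[R]_m) : \bar R :=
  ereal_inf [set Jpol pi | pi in admissible b].

(* Computed in the extended reals: a finite limit at 0^+ forces [Jstar] to be
   finite at 0 and near 0 along the [i]-th half-axis. *)
Definition Jstar_quotient (i : 'I_m) (t : R) : \bar R :=
  ((Jstar (t *: delta_mx i 0)%R - Jstar 0%R) * (t^-1)%:E)%E.

Definition LMV (i : 'I_m) : \bar R :=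
  (- lim (Jstar_quotient i t @[t --> 0^'+]))%E.

Definition price (lam : 'cV[R]_m -> 'cV[R]_m) (i : 'I_m) (w : T) (k : nat) : R :=
  lam (demand k w) i 0.

End Storage.

Section PriceProcess.
Context {R : realType}.

Definition seq_TV (N : nat) (x : nat -> R) : R :=
  \sum_(0 <= k < N.-1) `|x k.+1 - x k|.

Definition upcrossings (a b : R) (N : nat) (x : nat -> R) : nat :=
  count (fun k => (x k == b) && (x k.+1 == a)) (iota 0 N.-1).

End PriceProcess.

(* Main.v *)
(* Duality bounds the dispatch cost [Q] below by affine functions, one for each
   feasible choice of prices and line multipliers, and [lam x] attains the bound
   at [x].  On a forest, stationarity says that prices differ across a line only
   by that line's multiplier, so a price level strictly between [beta] and
   [alpha] could be moved up and down without losing dual feasibility, which is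
   impossible at a point where [Q] is differentiable.  Hence prices lie in
   {alpha, beta}.

   Near the finitely many demands [Q] is affine with slope [lam], so storage of
   small capacity [t] at node [i] is a linear arbitrage problem against the price
   process.  Its clairvoyant value, [t] times the sum of the price increases, is
   attained causally when only two prices occur: hold [t] exactly when the price
   is [beta]. *)
Require Import Defs.
From mathcomp Require Import all_boot all_order all_algebra.
From mathcomp Require Import all_classical all_reals all_analysis.
From mathcomp Require Import ring lra.
Import Order.TTheory GRing.Theory Num.Theory.
Import numFieldNormedType.Exports.

Set Implicit Arguments.
Unset Strict Implicit.
Unset Printing Implicit Defensive.

Local Open Scope classical_set_scope.
Local Open Scope ring_scope.

(** * Flows on acyclic networks, and the network matrices line by line *)

Section Forest.
Context {R : realType} {m l : nat}.
Variable net : network R m l.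
Notation src := (src net).
Notation tgt := (tgt net).
Notation y k := (susc net (src k) (tgt k)).

(* Summing the balance over the component of [src k] in the graph without line
   [k] isolates [w k]. *)
Lemma acyclic_flow_eq0 (w : 'I_l -> R) : acyclic_net net ->
  (forall r, \sum_k ((r == src k)%:R - (r == tgt k)%:R) * w k = 0) ->
  forall k, w k = 0.
Proof.
move=> acyc w0 k.
pose e' := [rel i j | joined src tgt i j &&
                      ([set i; j]%SET != [set src k; tgt k]%SET)].
have e'C : symmetric e' by move=> i j; rewrite /= /joined /= (finset.setUC [set i]%SET).
have e'_line k' : k' != k -> e' (src k') (tgt k').
  move=> k'k; apply/andP; split; first by apply/existsP; exists k'.
  by apply: contra k'k => /eqP /line_simple ->.
pose C := [set r | connect e' (src k) r]%SET.
have CE k' : k' != k -> (src k' \in C) = (tgt k' \in C).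
  move=> /e'_line e'k'; rewrite !inE.
  by apply: same_connect_r; [exact: sym_connect_sym | exact: connect1].
have tgtNC : tgt k \notin C.
  rewrite inE; apply/negP => /connectP[p pP tgtE].
  move: pP tgtE => /shortenP[p' p'P p'U _] tgtE.
  have p'J : path (joined src tgt) (src k) p' by apply: sub_path p'P => a b /andP[].
  have := acyc (src k :: p'); rewrite /ucycle /= rcons_path p'J -tgtE.
  move: p'U => /= ->; rewrite andbT.
  have -> : joined src tgt (tgt k) (src k).
    by apply/existsP; exists k; rewrite finset.setUC.
  move=> /(_ isT).
  (* Acyclicity leaves at most one edge in [p']: with none, line [k] would be a loop; a single one
     would join the endpoints of [k], which [e'] excludes. *)
  case: p' p'P tgtE {p'J} => [|a [|b p']] //=.
    by move=> _ tgtE; have := line_irrefl net k; rewrite tgtE eqxx.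
  by move=> /andP[/andP[_ +] _] tgtE; rewrite -tgtE eqxx.
have H (i : 'I_m) : \sum_(r in C) ((r == i)%:R : R) = (i \in C)%:R.
  rewrite big_mkcond (bigD1 i) //= eqxx big1 ?addr0; first by case: ifP.
  by move=> r /negPf ->; case: ifP.
(* Any line other than [k] has both endpoints in [C] or neither and cancels; line [k] contributes
   [w k]. *)
have : \sum_(r in C) \sum_k' ((r == src k')%:R - (r == tgt k')%:R) * w k' = 0.
  by rewrite big1.
rewrite exchange_big /= (bigD1 k) //= [X in _ + X]big1 ?addr0.
  rewrite -mulr_suml sumrB => /eqP; rewrite mulf_eq0 => /orP[|/eqP//].
  rewrite !H (negPf tgtNC) inE connect0 subr0.
  by rewrite oner_eq0.
move=> k' k'k; rewrite -mulr_suml sumrB.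
by rewrite !H CE // subrr mul0r.
Qed.

(** [Y] is a weighted graph Laplacian plus diagonal shunts, so the line sum is the net flow leaving
    [r]. *)
Lemma Ymx_mulE (la : 'cV[R]_m) r : (Ymx net *m la) r 0 =
  susc net r r * la r 0 +
  \sum_k ((r == src k)%:R - (r == tgt k)%:R) *
     (y k * (la (src k) 0 - la (tgt k) 0)).
Proof.
rewrite mxE (bigD1 r) //= mxE eqxx mulrDl -addrA; congr (_ + _).
transitivity (\sum_(j | j != r) susc net r j * (la r 0 - la j 0)).
  rewrite mulr_suml -big_split /=; apply: eq_bigr => j jr.
  by rewrite mxE eq_sym (negPf jr) mulrBr mulNr.
(* By [line_simple] exactly one line joins [r] to each neighbour, so the sum over neighbours becomes
   a sum over lines. *)
transitivity (\sum_(j | j != r) \sum_k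
   ([set src k; tgt k]%SET == [set r; j]%SET)%:R * (susc net r j * (la r 0 - la j 0))).
  apply: eq_bigr => j jr; rewrite -mulr_suml.
  have [/existsP[k /eqP kE]|nj] := boolP (joined src tgt r j).
    rewrite (bigD1 k) //=.
    have -> : ([set src k; tgt k] == [set r; j])%SET by exact/eqP.
    rewrite big1 ?addr0 ?mul1r //.
    move=> k' k'k; case: eqP => // k'E; exfalso; move/eqP: k'k; apply.
    by apply: line_simple; exact: etrans k'E (esym kE).
  by rewrite (susc_noline _ nj) 1?eq_sym// !mul0r mulr0.
rewrite exchange_big; apply: eq_bigr => k _ /=.
have st := line_irrefl net k.
have [rs|rs] := eqVneq r (src k).
  rewrite -rs in st *; rewrite (negPf st) subr0 mul1r (bigD1 (tgt k)) 1?eq_sym//=.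
  rewrite eqxx mul1r big1 ?addr0// => j /andP[jr jt].
  case: eqP => [/setP/(_ j)|]; last by rewrite mul0r.
  by rewrite !inE (negPf jr) (negPf jt) eqxx.
have [rt|rt] := eqVneq r (tgt k).
  rewrite -rt in st *; rewrite sub0r mulN1r -mulrN opprB susc_sym.
  rewrite (bigD1 (src k)) //= finset.setUC.
  rewrite eqxx mul1r big1 ?addr0// => j /andP[jr jt].
  case: eqP => [/setP/(_ j)|]; last by rewrite mul0r.
  by rewrite !inE (negPf jr) (negPf jt) eqxx.
rewrite subrr mul0r big1// => j _.
case: eqP => [/setP/(_ r)|]; last by rewrite mul0r.
by rewrite !inE (negPf rs) (negPf rt) eqxx.
Qed.

Lemma Bmx_mulE (th : 'cV[R]_m) k :
  (Bmx net *m th) k 0 = y k * (th (src k) 0 - th (tgt k) 0).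
Proof.
have st := line_irrefl net k.
rewrite mxE (bigD1 (src k)) //= mxE eqxx (bigD1 (tgt k)) 1?eq_sym//= mxE.
rewrite eq_sym (negPf st) eqxx big1 ?addr0; first by rewrite mulNr mulrBr.
by move=> r /andP[/negPf rs /negPf rt]; rewrite mxE rs rt mul0r.
Qed.

End Forest.

(** * Bilinearity of the scalar product *)

Section Dot.
Context {R : realType} {n : nat}.
Implicit Types x y z : 'cV[R]_n.

Lemma dotC x y : dot x y = dot y x.
Proof. by apply: eq_bigr => i _; rewrite mulrC. Qed.

Lemma dotDr x y z : dot x (y + z) = dot x y + dot x z.
Proof. by rewrite -big_split; apply: eq_bigr => i _; rewrite mxE mulrDr. Qed.

Lemma dotZr a x y : dot x (a *: y) = a * dot x y.
Proof. by rewrite mulr_sumr; apply: eq_bigr => i _; rewrite mxE mulrCA. Qed.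

Lemma dotNr x y : dot x (- y) = - dot x y.
Proof. by rewrite -scaleN1r dotZr mulN1r. Qed.

Lemma dotDl x y z : dot (x + y) z = dot x z + dot y z.
Proof. by rewrite !(dotC _ z) dotDr. Qed.

Lemma dotNl x y : dot (- x) y = - dot x y.
Proof. by rewrite !(dotC _ y) dotNr. Qed.

Lemma dotZl a x y : dot (a *: x) y = a * dot x y.
Proof. by rewrite !(dotC _ y) dotZr. Qed.

Lemma dot0r x : dot x 0 = 0.
Proof. by rewrite -(scale0r 0) dotZr mul0r. Qed.

Lemma dot_delta x i : dot x (delta_mx i 0) = x i 0.
Proof.
rewrite /dot (bigD1 i) //= big1 ?addr0 => [|j /negPf ji]; rewrite mxE ?ji ?mulr0//.
by rewrite !eqxx mulr1.
Qed.

Lemma ler_dot2l x y z : (forall k, 0 <= x k 0) -> (forall k, y k 0 <= z k 0) ->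
  dot x y <= dot x z.
Proof. by move=> x0 yz; apply: ler_sum => k _; exact: ler_wpM2l. Qed.

End Dot.

Lemma min_positive_family (R : realType) (n : nat) (Q : pred 'I_n) (a : 'I_n -> R) :
  (forall k, Q k -> 0 < a k) ->
  exists2 s, 0 < s & forall k, Q k -> s <= a k.
Proof.
move=> a0; exists (\big[Num.min/1]_(k | Q k) a k).
  by apply: lt_bigmin.
by move=> k Qk; exact: bigmin_le_cond.
Qed.

(** * Lagrangian duality for the dispatch problem *)

Section Duality.
Context {R : realType} {m l : nat}.
Variables (net : network R m l) (al be : 'I_m -> R).
Notation src := (src net).
Notation tgt := (tgt net).
Notation y k := (susc net (src k) (tgt k)).

(** Collecting the coefficients of [th] lets stationarity be read off node by node and line by
    line. *)
Lemma dot_network (la th : 'cV[R]_m) (D : 'cV[R]_l) :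
  dot la (Ymx net *m th) + dot D (Bmx net *m th) =
  \sum_r susc net r r * la r 0 * th r 0 +
  \sum_k y k * (la (src k) 0 - la (tgt k) 0 + D k 0) *
         (th (src k) 0 - th (tgt k) 0).
Proof.
have H (c : 'cV[R]_m) k :
    \sum_r c r 0 * ((r == src k)%:R - (r == tgt k)%:R) =
    c (src k) 0 - c (tgt k) 0.
  under eq_bigr do rewrite mulrBr; rewrite sumrB; congr (_ - _).
    by rewrite (bigD1 (src k)) //= eqxx mulr1 big1 ?addr0// => r /negPf->; rewrite mulr0.
  by rewrite (bigD1 (tgt k)) //= eqxx mulr1 big1 ?addr0// => r /negPf->; rewrite mulr0.
have -> : dot la (Ymx net *m th) = \sum_r susc net r r * la r 0 * th r 0 +
    \sum_k y k * (la (src k) 0 - la (tgt k) 0) * (th (src k) 0 - th (tgt k) 0).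
  rewrite /dot; under eq_bigr do rewrite Ymx_mulE mulrDr mulr_sumr.
  rewrite big_split /=; congr (_ + _); first by apply: eq_bigr => r _; ring.
  rewrite exchange_big; apply: eq_bigr => k _ /=.
  under eq_bigr do rewrite mulrA; rewrite -mulr_suml H; ring.
rewrite -addrA; congr (_ + _); rewrite /dot -big_split; apply: eq_bigr => k _ /=.
by rewrite Bmx_mulE; ring.
Qed.

(* Testing with a common voltage kills the shunt terms, since prices and shunts
   are nonnegative; what remains is a balanced flow on a forest. *)
Lemma acyclic_stationary (la : 'cV[R]_m) (D : 'cV[R]_l) :
  acyclic_net net -> (forall i, 0 <= la i 0) ->
  (forall th, dot la (Ymx net *m th) + dot D (Bmx net *m th) = 0) <->
  (forall r, susc net r r * la r 0 = 0) /\
  (forall k, y k * (la (src k) 0 - la (tgt k) 0 + D k 0) = 0).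
Proof.
move=> acyc la0; split=> [st|[sh ln] th]; last first.
  rewrite dot_network big1 ?add0r => [|r _]; last by rewrite sh mul0r.
  by rewrite big1 // => k _; rewrite ln mul0r.
have sh r : susc net r r * la r 0 = 0.
  have := st (const_mx 1); rewrite dot_network [X in _ + X]big1 ?addr0; last first.
    by move=> k _; rewrite !mxE subrr mulr0.
  under eq_bigr do rewrite mxE mulr1.
  move/eqP; rewrite psumr_eq0 => [/allP/(_ r (mem_index_enum _))/eqP//|i _].
  by rewrite mulr_ge0 ?shunt_ge0.
split=> // k.
apply: (acyclic_flow_eq0 (w := fun k => y k * (la (src k) 0 - la (tgt k) 0 + D k 0)))
  acyc _ k => r.
(* A unit voltage at [r] yields the flow balance at [r]. *)
have := st (delta_mx r 0); rewrite dot_network big1 ?add0r => [|j _]; last first.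
  by rewrite sh mul0r.
move=> {2}<-; apply: eq_bigr => k _.
by rewrite !mxE eqxx !andbT ![r == _]eq_sym mulrC.
Qed.

(** The conditions for the Lagrangian to be bounded below: the price bounds come from minimising
    over [v], stationarity from minimising over [th]. *)
Record dual_feasible (la : 'cV[R]_m) (ep em : 'cV[R]_l) : Prop := DualFeasible {
  dual_price : forall i, be i <= la i 0 <= al i;
  dual_ep_ge0 : forall k, 0 <= ep k 0;
  dual_em_ge0 : forall k, 0 <= em k 0;
  dual_stationary : forall th,
    dot la (Ymx net *m th) + dot (ep - em) (Bmx net *m th) = 0
}.

(** The infimum of the Lagrangian over [v] and [th] at a dual feasible point. *)
Definition dual_value (x la : 'cV[R]_m) (ep em : 'cV[R]_l) : R :=
  dot la x - dot (ep + em) (cap net).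

Lemma dot_le_gcost (la v : 'cV[R]_m) :
  (forall i, be i <= la i 0 <= al i) -> dot la v <= gcost al be v.
Proof.
move=> h; apply: ler_sum => i _; have /andP[h1 h2] := h i.
have [v0|v0] := orP (le_total 0 (v i 0)).
  rewrite (max_l v0) (@max_r _ _ (- _)) ?oppr_le0// mulr0 subr0.
  exact: ler_wpM2r.
rewrite (max_r v0) (@max_l _ _ (- _)) ?oppr_ge0//.
by rewrite mulr0 sub0r mulrN opprK ler_wnM2r.
Qed.

Lemma weak_duality (x v la : 'cV[R]_m) (ep em : 'cV[R]_l) :
  dual_feasible la ep em -> injection_polytope net (v - x) ->
  dual_value x la ep em <= gcost al be v.
Proof.
move=> [la_bd ep0 em0 st] [th [vE thP]].
apply: le_trans _ (dot_le_gcost v la_bd).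
have -> : v = x + Ymx net *m th by rewrite -vE addrC subrK.
(* Stationarity trades the balance term [Y th] for the line term [B th], which the capacities
   bound. *)
have /eqP := st th; rewrite dotDr addr_eq0 => /eqP ->.
rewrite lerD2l dotDl dotDl opprD dotNl opprD opprK lerD// ?lerN2.
  by apply: ler_dot2l => // k; have /andP[] := thP k.
rewrite -dotNr; apply: ler_dot2l => // k; rewrite mxE.
by have /andP[] := thP k.
Qed.

Lemma linear_ge_eq0 (a c : R) : (forall s, 0 <= s -> c <= s * a) -> 0 <= a.
Proof.
move=> h; rewrite leNgt; apply/negP => a0.
(* This [s] makes [s * a] equal to [- (|c| + 1)], which is below [c]. *)
have : c <= (`|c| + 1) / - a * a.
  by apply: h; rewrite divr_ge0 ?oppr_ge0 ?(ltW a0)// addr_ge0.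
rewrite invrN mulrN mulNr -mulrA mulVf ?lt_eqF// mulr1.
have := ler_norm (- c); rewrite normrN; lra.
Qed.

(** The Lagrangian is at least [q] and, up to a constant, positively homogeneous: boundedness along
    rays forces dual feasibility, and evaluation at the origin bounds [q]. *)
Lemma multiplier_dual (x la : 'cV[R]_m) (q : R) :
  is_multiplier net al be x la -> dispatch net al be x = q%:E ->
  exists ep em, dual_feasible la ep em /\ q <= dual_value x la ep em.
Proof.
move=> [ep [em [ep0 em0 dE]]] qE; exists ep, em.
have L v th : q <= gcost al be v - dot la v + dual_value x la ep em +
    (dot la (Ymx net *m th) + dot (ep - em) (Bmx net *m th)).
  rewrite -lee_fin -qE dE; apply: ereal_inf_lbound; exists (v, th) => //=.
  congr EFin; rewrite /lagrangian /dual_value !(dotDr, dotDl, dotNr, dotNl); ring.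
have g0 : gcost al be 0 = 0.
  by rewrite /gcost big1 // => i _; rewrite !mxE oppr0 maxxx !mulr0 subrr.
split; last first.
  by have := L 0 0; rewrite !mulmx0 !dot0r g0; lra.
split=> // [i|th].
  have gd s : gcost al be (s *: delta_mx i 0) =
      al i * Num.max s 0 - be i * Num.max (- s) 0.
    rewrite /gcost (bigD1 i) //= big1 ?addr0.
      by rewrite !mxE !eqxx mulr1.
    by move=> j /negPf ji; rewrite !mxE ji mulr0 oppr0 maxxx !mulr0 subrr.
  (* The rays [v = - s e_i] and [v = s e_i] give the lower and the upper price bound. *)
  apply/andP; split; rewrite -subr_ge0;
    apply: (@linear_ge_eq0 _ (q - dual_value x la ep em)) => s s0.
    have := L (- s *: delta_mx i 0) 0; rewrite !mulmx0 !dot0r gd dotZr dot_delta.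
    rewrite max_r ?oppr_le0// opprK max_l//; nra.
  have := L (s *: delta_mx i 0) 0; rewrite !mulmx0 !dot0r gd dotZr dot_delta.
  rewrite max_l// max_r ?oppr_le0//; nra.
set a := _ + _; have {}L s : q - dual_value x la ep em <= s * a.
  have := L 0 (s *: th); rewrite -!scalemxAr !dotZr g0 dot0r -/a.
  rewrite /a; lra.
apply/eqP; rewrite eq_le -oppr_ge0; apply/andP; split.
  by apply: (@linear_ge_eq0 _ (q - dual_value x la ep em)) => s _; have := L (- s); rewrite mulrN mulNr.
by apply: (@linear_ge_eq0 _ (q - dual_value x la ep em)).
Qed.

End Duality.

(** * Arbitrage against a scalar price sequence *)

Section Seqs.
Context {R : realType}.
Implicit Types x z : nat -> R.

(** Abel summation turns trading costs into the value of the final stock minus the price increases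
    earned while holding. *)
Lemma sum_by_parts x z n : z 0%N = 0 ->
  \sum_(k < n.+1) x k * (z k.+1 - z k) =
  x n * z n.+1 - \sum_(k < n) (x k.+1 - x k) * z k.+1.
Proof.
move=> z0; elim: n => [|n IHn].
  by rewrite big_ord_recr !big_ord0 /= add0r z0 !subr0.
by rewrite big_ord_recr /= IHn [in RHS]big_ord_recr /=; ring.
Qed.

(** The positive variation: for nonnegative prices, the best clairvoyant profit of a unit store. *)
Definition gains N x : R := \sum_(k < N.-1) Num.max (x k.+1 - x k) 0.

(** The positive part of an increment [d] is half of [|d| + d], and the increments telescope. *)
Lemma TV_gains N x : 2^-1 * seq_TV N x + 2^-1 * (x N.-1 - x 0%N) = gains N x.
Proof.
rewrite /seq_TV /gains -(@telescope_sumr _ 0 N.-1 x)// -mulrDr.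
rewrite -big_split /= mulr_sumr big_mkord; apply: eq_bigr => k _.
have [d0|d0] := orP (le_total 0 (x k.+1 - x k)).
  by rewrite ger0_norm// max_l//; field.
by rewrite ler0_norm// max_r//; ring.
Qed.

Lemma upcrossings_gains (a b : R) N x : b <= a ->
  (forall k, (k < N)%N -> x k = a \/ x k = b) ->
  (a - b) * (upcrossings a b N x)%:R = gains N x.
Proof.
move=> ba xab.
have -> : upcrossings a b N x =
    (\sum_(k < N.-1) ((x k == b) && (x k.+1 == a)))%N.
  by rewrite /upcrossings -sum1_count big_mkcond -[X in iota 0 X]subn0 big_mkord.
rewrite natr_sum mulr_sumr; apply: eq_bigr => -[k kN] _ /=.
have kN' : (k.+1 < N)%N by move: kN; case: N {xab}.
have [->|->] := xab k (ltnW kN'); have [->|->] := xab _ kN'.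
(* When [a = b], steady pairs also count as upcrossings, but the factor [a - b] is then zero. *)
- rewrite subrr maxxx eqxx andbT; case: eqP => [->|]; rewrite ?subrr ?mul0r ?mulr0//.
- rewrite max_r ?subr_le0//; case: eqP => [->|]; rewrite ?subrr ?mul0r ?mulr0//.
- by rewrite max_l ?subr_ge0// !eqxx mulr1.
- rewrite subrr maxxx eqxx; case: eqP => [->|]; rewrite ?subrr ?mul0r ?mulr0//.
Qed.

Lemma arbitrage_ge (t : R) N x z : (0 < N)%N -> z 0%N = 0 ->
  (forall k, (k < N)%N -> 0 <= x k) ->
  (forall k, (k < N)%N -> 0 <= z k.+1 <= t) ->
  - (t * gains N x) <= \sum_(k < N) x k * (z k.+1 - z k).
Proof.
case: N => // N _ z0 x0 zt; rewrite sum_by_parts// lerBrDr.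
apply: (@le_trans _ _ 0); last first.
  by rewrite mulr_ge0 ?x0//; have /andP[] := zt N (ltnSn N).
rewrite addrC subr_le0 /gains /= mulr_sumr; apply: ler_sum => -[k kN] _ /=.
have /andP[zk0 zkt] := zt k (ltnW kN).
have [d0|d0] := orP (le_total 0 (x k.+1 - x k)).
  by rewrite max_l// mulrC ler_wpM2r.
by rewrite max_r// mulr0 mulr_le0_ge0.
Qed.

(* Holding [t] exactly at the low price misses no price increase when only two
   prices occur. *)
Lemma arbitrage_eq (a b t : R) N x z : b <= a -> (0 < N)%N -> z 0%N = 0 ->
  (forall k, (k < N)%N -> x k = a \/ x k = b) ->
  (forall k, (k < N)%N ->
     z k.+1 = if (k < N.-1)%N && (x k == b) then t else 0) ->
  \sum_(k < N) x k * (z k.+1 - z k) = - (t * gains N x).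
Proof.
move=> ba; case: N => // N _ z0 xab zt; rewrite sum_by_parts//.
rewrite (zt N)//= ltnn mulr0 sub0r; congr (- _).
rewrite /gains mulr_sumr; apply: eq_bigr => -[k kN] _ /=.
rewrite (zt k (ltnW kN))/= kN /=.
have [->|->] := xab k (ltnW kN); have [->|->] := xab k.+1 kN;
  rewrite ?subrr ?maxxx ?mul0r ?mulr0//.
  by rewrite max_r ?subr_le0// mulr0; case: eqP => [->|]; rewrite ?subrr ?mul0r ?mulr0.
by rewrite eqxx max_l ?subr_ge0// mulrC.
Qed.

End Seqs.

(** * Random variables that factor through a finite type *)

Section FiniteRange.
Context {d : measure_display} {T : measurableType d} {R : realType}.
Variable P : probability T R.

Section Determined.
Context {U : finType}.
Variable D : T -> U.
Hypothesis mD : forall h, measurable (D @^-1` [set h]).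

(** Control laws carry no measurability condition; measurability and integrability of costs come
    from factoring through the finite-valued map [D]. *)
Definition determined (f : T -> R) := forall w w', D w = D w' -> f w = f w'.

Lemma determined_factor (f : T -> R) : determined f -> exists F, f = F \o D.
Proof.
move=> fD.
have [F FP] : {F : U -> R & forall h, forall w, D w = h -> f w = F h}.
  apply: (@choice U R (fun h r => forall w, D w = h -> f w = r)) => h.
  have [[w wh]|nw] := pselect (exists w, D w = h).
    by exists (f w) => w' w'h; apply: fD; rewrite w'h wh.
  by exists 0 => w wh; exfalso; apply: nw; exists w.
by exists F; apply/funext => w; exact: FP.
Qed.

Lemma determined_measurable f : determined f -> measurable_fun setT f.
Proof.
move=> /determined_factor[F ->] _ B mB; rewrite setTI.
have -> : (F \o D) @^-1` B = \bigcup_(h in F @^-1` B) D @^-1` [set h].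
  apply/seteqP; split=> [w Bw|w [h Fh wh]]; first by exists (D w).
  by rewrite /preimage /= wh.
by apply: fin_bigcup_measurable => // ; exact: finite_finset.
Qed.

Lemma determined_integrable f : determined f -> P.-integrable setT (EFin \o f).
Proof.
move=> fD; apply: measurable_bounded_integrable => //.
- by rewrite (le_lt_trans (probability_le1 P measurableT)) ?ltry.
- exact: determined_measurable.
have [F ->] := determined_factor fD.
exists (\sum_h `|F h|); split; first exact: num_real.
move=> M M1 w _ /=; apply/ltW/le_lt_trans/M1.
by rewrite (bigD1 (D w)) //= lerDl sumr_ge0.
Qed.

Lemma determined_Lfun f : determined f -> f \in Lfun P 1.
Proof. by move=> fD; apply/Lfun1_integrable; exact: determined_integrable. Qed.

Lemma determined_le_ae f g : determined f -> determined g ->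
  {ae P, forall w, f w <= g w} -> ('E_P[f] <= 'E_P[g])%E.
Proof.
move=> fD gD fg; rewrite unlock.
(* The inequality is only almost sure; [h] dominates [f] everywhere and equals [g] almost
   everywhere. *)
pose h w := Num.max (f w) (g w).
have hD : determined h by move=> w w' ww'; rewrite /h (fD _ _ ww') (gD _ _ ww').
apply: (@le_trans _ _ (\int[P]_w (h w)%:E)%E).
  apply: le_integral => //; [exact: determined_integrable fD|exact: determined_integrable hD|].
  by move=> w _; rewrite lee_fin le_max lexx.
rewrite le_eqVlt; apply/orP; left; apply/eqP; apply: ae_eq_integral => //.
- exact: measurable_int (determined_integrable hD).
- exact: measurable_int (determined_integrable gD).
by apply: filterS fg => w fgw _; rewrite /h max_r.
Qed.

End Determined.
End FiniteRange.

(** * Prices at demands around which the dispatch cost is affine *)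

Section LocalPrice.
Context {R : realType} {m l : nat}.
Variables (net : network R m l) (al be : 'I_m -> R).
Notation src := (src net).
Notation tgt := (tgt net).
Notation y k := (susc net (src k) (tgt k)).
Notation Q := (dispatch net al be).

Definition locally_affine (x la : 'cV[R]_m) (e : R) : Prop :=
  exists q : R, forall h : 'cV[R]_m, (forall j, `|h j 0| < e) ->
    Q (x + h) = (q + dot la h)%:E.

Lemma locally_affine_le (x la : 'cV[R]_m) (e e' : R) :
  e' <= e -> locally_affine x la e -> locally_affine x la e'.
Proof.
by move=> ee' [q H]; exists q => h he; apply: H => j; exact: lt_le_trans ee'.
Qed.

(* If an intermediate price level existed, all nodes at that level could be
   repriced simultaneously in both directions: the lines leaving the level set
   are congested, so their multipliers absorb the change.  This would give a
   second optimal dual solution, contradicting differentiability. *)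
Lemma acyclic_price_extreme (x la : 'cV[R]_m) (e alpha beta : R) (i : 'I_m) :
  acyclic_net net -> 0 <= beta -> (forall j, al j = alpha /\ be j = beta) ->
  is_multiplier net al be x la -> 0 < e -> locally_affine x la e ->
  la i 0 = alpha \/ la i 0 = beta.
Proof.
move=> acyc beta0 hom mult e0 [q Qaff].
have Qx : Q x = q%:E.
  by have := Qaff 0; rewrite addr0 dot0r addr0; apply => j; rewrite mxE normr0.
have [ep [em [feas qle]]] := multiplier_dual mult Qx.
have [la_bd ep0 em0 /acyclic_stationary st] := feas.
have la0 j : 0 <= la j 0.
  by have /andP[+ _] := la_bd j; apply: le_trans; rewrite (hom j).2.
have {st}[sh ln] := st acyc la0.
have /andP[] := la_bd i; rewrite (hom i).1 (hom i).2.
rewrite le_eqVlt => /orP[/eqP->|bi]; first by right.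
rewrite le_eqVlt => /orP[/eqP->|ia]; first by left.
exfalso.
pose c := la i 0.
pose de : 'cV[R]_m := \col_j (la j 0 == c)%:R.
pose D k := ep k 0 - em k 0.
(* Repricing by [t *: de] changes the price drop on line [k] by [t * eta k], so [D k] must change by
   the opposite; a line of zero susceptance needs no correction. *)
pose eta k : R := if y k == 0 then 0 else de (src k) 0 - de (tgt k) 0.
have eta1 k : `|eta k| <= 1.
  rewrite /eta; case: ifP; rewrite ?normr0// !mxE.
  by case: (_ == c); case: (_ == c); rewrite ?subrr ?subr0 ?sub0r ?normrN ?normr0 ?normr1 ?ler01.
have etaD k : eta k != 0 -> D k != 0.
  rewrite /eta; case: ifPn => [|yk]; rewrite ?eqxx//.
  apply: contraNneq => Dk; have /eqP := ln k; rewrite mulf_eq0 (negPf yk) /=.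
  rewrite !mxE -/(D k) Dk addr0 subr_eq0 => /eqP ->.
  by rewrite subrr.
have [|s1 s1_gt0 s1P] :=
    @min_positive_family _ _ (fun k => D k != 0) (fun k => `|D k|).
  by move=> k; rewrite normr_gt0.
(* Steps up to [s] keep the moved level in [[beta, alpha]] and stay below every nonzero [|D k|]. *)
pose s := Num.min s1 (Num.min (alpha - c) (c - beta)).
have s0 : 0 < s by rewrite !lt_min s1_gt0 !subr_gt0 ia bi.
have ss1 : s <= s1 by rewrite ge_min lexx.
have sa : s <= alpha - c by rewrite !ge_min lexx !orbT.
have sb : s <= c - beta by rewrite !ge_min lexx !orbT.
pose la' t : 'cV[R]_m := la + t *: de.
(* The change is charged to the line multiplier that is at least [|D k|], so it stays
   nonnegative. *)
pose cp : 'cV[R]_l := \col_k (if 0 < D k then - eta k else 0).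
pose cm : 'cV[R]_l := \col_k (if 0 < D k then 0 else eta k).
have feas' t : `|t| <= s -> dual_feasible net al be (la' t) (ep + t *: cp) (em + t *: cm).
  move=> ts.
  have la'_bd j : be j <= la' t j 0 <= al j.
    have := la_bd j; rewrite (hom j).1 (hom j).2 !mxE.
    case: eqP => [->|_]; last by rewrite mulr0 addr0.
    by rewrite mulr1 => _; move: ts; rewrite ler_norml; lra.
  have eta_le k : eta k != 0 -> `|t * eta k| <= `|D k|.
    move=> /etaD /s1P; rewrite normrM => sD.
    apply: le_trans (le_trans ss1 sD); apply: le_trans ts.
    by rewrite ler_piMr.
  have eta_bd k : eta k = 0 \/ (D k != 0 /\ `|t * eta k| <= `|D k|).
    by have [->|h] := eqVneq (eta k) 0; [left | right; split; [exact: etaD|exact: eta_le]].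
  split => // [k|k|].
  - rewrite !mxE; case: ifP => [Dk|_]; last by rewrite mulr0 addr0.
    have [->|[_]] := eta_bd k; first by rewrite oppr0 mulr0 addr0.
    rewrite ler_norml (gtr0_norm Dk) mulrN.
    by have := em0 k; rewrite /D; lra.
  - rewrite !mxE; case: ifPn => [_|]; first by rewrite mulr0 addr0.
    rewrite -leNgt => Dk.
    have [->|[_]] := eta_bd k; first by rewrite mulr0 addr0.
    rewrite ler_norml (ler0_norm Dk).
    by have := ep0 k; rewrite /D; lra.
  have la'0 j : 0 <= la' t j 0.
    by have /andP[+ _] := la'_bd j; apply: le_trans; rewrite (hom j).2.
  apply/(acyclic_stationary _ acyc la'0); split=> [r|k].
    (* A node at level [c > beta >= 0] has a positive price, so [sh] forces its shunt to vanish. *)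
    rewrite !mxE mulrDr sh add0r; case: eqP => [lar|]; last by rewrite !mulr0.
    rewrite mulr1; have /eqP := sh r; rewrite lar mulf_eq0 => /orP[/eqP->|].
      by rewrite mul0r.
    by move=> c0; move: bi; rewrite -/c (eqP c0) ltNge beta0.
  have [->|yk] := eqVneq (y k) 0; first by rewrite mul0r.
  have := ln k; rewrite !mxE => lnk.
  have -> : forall a b : R, la (src k) 0 + a - (la (tgt k) 0 + b) +
     (ep k 0 + t * (if 0 < D k then - eta k else 0)
      - (em k 0 + t * (if 0 < D k then 0 else eta k))) =
     (la (src k) 0 - la (tgt k) 0 + (ep k 0 - em k 0)) + (a - b - t * eta k).
    by move=> a b; case: ifP => _; ring.
  rewrite mulrDr lnk add0r /eta (negPf yk) !mxE; ring.
pose val t z := dual_value net z (la' t) (ep + t *: cp) (em + t *: cm).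
have val_le t (h : 'cV[R]_m) : `|t| <= s -> (forall j, `|h j 0| < e) -> val t (x + h) <= q + dot la h.
  move=> ts he; rewrite -lee_fin -Qaff//; apply/ereal_infP => _ [v vP <-].
  by rewrite lee_fin; apply: weak_duality vP; exact: feas'.
pose tau := e / 2.
have tau0 : 0 < tau by rewrite divr_gt0.
have s_norm : `|s| <= s by rewrite ger0_norm // ltW.
have Ns_norm : `|- s| <= s by rewrite normrN.
have h0 j : `|(0 : 'cV[R]_m) j 0| < e by rewrite mxE normr0.
have ht j : `|(tau *: delta_mx i 0 : 'cV[R]_m) j 0| < e.
  rewrite !mxE andbT; case: (j == i); rewrite ?mulr1 ?mulr0 ?normr0//.
  by rewrite gtr0_norm // /tau; lra.
(* Adding the bounds at [(- s, x)] and [(s, x + tau e_i)] cancels the terms linear in [s] and leaves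
   [s * tau <= 0]. *)
have := val_le _ _ Ns_norm h0; have := val_le _ _ s_norm ht.
move: qle; rewrite /val /dual_value /la' !(dotDl, dotDr, dotNr, dotZl, dotZr, dot_delta, dot0r).
have -> : de i 0 = 1 by rewrite mxE eqxx.
have : 0 < s * tau by rewrite mulr_gt0.
lra.
Qed.

Lemma affine_differential (f : 'cV[R]_m -> R) (a : 'cV[R]_m) (c : R) (x : 'cV[R]_m)
    (h : 'cV[R]_m) :
  (\forall z \near x, f z = dot a z + c) -> differentiable f x ->
  'd f x h = dot a h.
Proof.
move=> fE df; rewrite -deriveE// /derive; apply: cvg_lim => //.
apply: cvg_near_cst.
have fx := nbhs_singleton fE.
have tx : (fun t : R => t *: h + x) @ (0 : R) --> (0 : R) *: h + x.
  by apply: cvgD; [apply: cvgZr_tmp; exact: cvg_id | exact: cvg_cst].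
rewrite scale0r add0r in tx.
have ne := nbhs_dnbhs (tx _ fE).
near=> t.
have t0 : t != 0 by near: t; exact: nbhs_dnbhs_neq.
rewrite /= fx (_ : f (t *: h + x) = dot a (t *: h + x) + c); last by near: t.
rewrite dotDr dotZr /GRing.scale /=; field.
Unshelve. all: by end_near. Qed.

Lemma partition_locally_affine (lam : 'cV[R]_m -> 'cV[R]_m)
    (Xi K : set 'cV[R]_m) p (S : 'I_p -> set 'cV[R]_m) (x : 'cV[R]_m) :
  price_partition net al be lam Xi K S ->
  Xi `&` partition_boundary S = set0 -> Xi x ->
  exists2 e, 0 < e & locally_affine x (lam x) e.
Proof.
move=> part XiS Xix.
have Kx : K x by apply: nbhs_singleton; exact: (dom_demand part).
move: Kx; rewrite -(part_cover part) => -[j _ Sjx].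
have Sjx' : (S j)° x.
  apply: contrapT => nSjx; have : set0 x by rewrite -XiS; split => //; exists j.
  by [].
have [a [c aff]] := part_affine part j.
have [df dE] := part_gradient part Sjx'.
(* The derivative of [Q] at [x] is given both by the slope [a] of the cell and by the price. *)
have la h : dot (lam x) h = dot a h.
  rewrite -dE; apply: (@affine_differential _ a c) => //.
  by apply: filterS Sjx' => z /aff /= ->.
move: Sjx'; rewrite /interior nbhs_ballP => -[e /= e0 eS]; exists e => //.
exists (dot a x + c) => h he; rewrite la aff ?dotDr 1?addrAC//.
apply: eS; rewrite /ball /= /mx_ball; split=> // i k.
rewrite (ord1 k) mxE /ball /= opprD addNKr normrN.
exact: he.
Qed.

(** One radius for all demands gives one range of capacities on which storage acts linearly along
    every path. *)
Lemma finite_locally_affine (lam : 'cV[R]_m -> 'cV[R]_m) (Xi : set 'cV[R]_m) :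
  finite_set Xi ->
  (forall x, Xi x -> exists2 e, 0 < e & locally_affine x (lam x) e) ->
  exists2 e, 0 < e & forall x, Xi x -> locally_affine x (lam x) e.
Proof.
move=> /finite_seqP[xs ->].
elim: xs => [|x xs IH] Xaff; first by exists 1.
have [|e e0 eP] := IH; first by move=> z /= zxs; apply: Xaff; rewrite /= inE zxs orbT.
have [|e' e'0 e'P] := Xaff x; first by rewrite /= inE eqxx.
exists (Num.min e e'); first by rewrite lt_min e0.
move=> z /=; rewrite inE => /orP[/eqP ->|/eP].
  by apply: locally_affine_le e'P; rewrite ge_min lexx orbT.
by apply: locally_affine_le; rewrite ge_min lexx.
Qed.

End LocalPrice.

(** * Histories as functions of the demand path, for finitely many demands *)

Section Histories.
Context {R : realType} {m : nat} {d : measure_display} {T : measurableType d}.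
Variables (P : probability T R) (xi : nat -> 'I_m -> {RV P >-> R}).

Lemma demand_hist_ext k w w' :
  (forall j, (j <= k)%N -> demand xi j w = demand xi j w') ->
  demand_hist xi k w = demand_hist xi k w'.
Proof.
by move=> ww'; apply: eq_from_tnth => j; rewrite !tnth_mktuple ww'// -ltnS.
Qed.

Lemma storage_hist_ext pi k w w' :
  (forall j, (j < k)%N -> demand xi j w = demand xi j w') ->
  storage_hist xi pi w k = storage_hist xi pi w' k.
Proof.
elim: k => [//|k IHk] ww' /=.
rewrite (@demand_hist_ext k w w') ?IHk// => j jk; apply: ww'.
exact: ltnW.
Qed.

Lemma vcontrol_ext pi k w w' :
  (forall j, (j <= k)%N -> demand xi j w = demand xi j w') ->
  vcontrol xi pi k w = vcontrol xi pi k w'.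
Proof.
move=> ww'; rewrite /vcontrol (demand_hist_ext ww') (@storage_hist_ext pi k w w')//.
by move=> j jk; exact/ww'/ltnW.
Qed.

Lemma storageS pi k w : storage xi pi k.+1 w = storage xi pi k w + ucontrol xi pi k w.
Proof.
by rewrite /storage (tnth_nth 0) /= nth_rcons size_tuple ltnn eqxx.
Qed.

Lemma storage0 pi w : storage xi pi 0 w = 0.
Proof. by rewrite /storage (tnth_nth 0). Qed.

Lemma tnth_demand_hist k w : tnth (demand_hist xi k w) ord_max = demand xi k w.
Proof. by rewrite tnth_mktuple. Qed.

(** Storage states are themselves functions of past demands, so the cost of any policy has this
    property. *)
Definition causal N (f : T -> R) := forall w w',
  (forall k, (k < N)%N -> demand xi k w = demand xi k w') -> f w = f w'.

Section FiniteDemand.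
Variables (N : nat) (s : seq 'cV[R]_m).
Hypothesis xi_in : forall k w, (k < N)%N -> demand xi k w \in s.

(** The finite-valued map [D] for demand paths; the extra ordinal is room for [size s], the index of
    an absent element. *)
Definition demand_code (w : T) : {ffun 'I_N -> 'I_(size s).+1} :=
  [ffun k : 'I_N => inord (index (demand xi k w) s)].

Lemma demand_code_inj w w' : demand_code w = demand_code w' ->
  forall k, (k < N)%N -> demand xi k w = demand xi k w'.
Proof.
move=> /ffunP ww' k kN; have := ww' (Ordinal kN); rewrite !ffunE /=.
move=> /(congr1 val); rewrite /= !inordK ?ltnS ?index_size// => ii.
by rewrite -(nth_index 0 (xi_in w kN)) ii nth_index// xi_in.
Qed.

Lemma demand_code_measurable h : measurable (demand_code @^-1` [set h]).
Proof.
(* A fibre is a finite combination of level sets of the coordinates [xi k i]. *)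
have -> : demand_code @^-1` [set h] =
    \bigcap_(k in [set: 'I_N]) \bigcup_(x in [set x | x \in s /\ inord (index x s) = h k])
      \bigcap_(i in [set: 'I_m]) (xi k i @^-1` [set x i 0]).
  apply/seteqP; split=> [w <- k _|w wh].
    exists (demand xi k w) => /=; first by rewrite ffunE; split=> //; exact: xi_in.
    by move=> i _ /=; rewrite mxE.
  apply/ffunP => k; rewrite ffunE.
  have [x [_ <-] xw] := wh k I; congr (inord (index _ _)).
  by apply/colP => i; rewrite mxE; exact: xw.
apply: fin_bigcap_measurable => [|k _]; first exact: finite_finset.
apply: fin_bigcup_measurable => [|x _].
  by apply: (sub_finite_set (B := [set` s])) => // x [].
apply: fin_bigcap_measurable => [|i _]; first exact: finite_finset.
by rewrite -[X in measurable X]setTI; exact: measurable_funP.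
Qed.

Lemma causal_determined f : causal N f -> determined demand_code f.
Proof. by move=> fN w w' /demand_code_inj; exact: fN. Qed.

Lemma causal_Lfun f : causal N f -> f \in Lfun P 1.
Proof.
by move=> /causal_determined; apply: determined_Lfun; exact: demand_code_measurable.
Qed.

Lemma causal_le_ae f g : causal N f -> causal N g ->
  {ae P, forall w, f w <= g w} -> ('E_P[f] <= 'E_P[g])%E.
Proof.
move=> /causal_determined fD /causal_determined gD.
by apply: (determined_le_ae demand_code_measurable).
Qed.

End FiniteDemand.
End Histories.

(** * Optimal cost with a small store at a single node *)

Section MarginalValue.
Context {R : realType} {m l : nat} {d : measure_display} {T : measurableType d}.
Variables (net : network R m l) (al be : 'I_m -> R) (P : probability T R).
Variables (N : nat) (xi : nat -> 'I_m -> {RV P >-> R}).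
Variables (s : seq 'cV[R]_m) (lam : 'cV[R]_m -> 'cV[R]_m).
Variables (e alpha beta : R) (i : 'I_m).
Hypothesis N_gt0 : (0 < N)%N.
Hypothesis xi_in : forall k w, (k < N)%N -> demand xi k w \in s.
Hypothesis e_gt0 : 0 < e.
Hypothesis Q_affine : forall x, x \in s -> locally_affine net al be x (lam x) e.
Hypothesis alpha_beta : 0 <= beta <= alpha.
Hypothesis lam_ab : forall x, x \in s -> lam x i 0 = alpha \/ lam x i 0 = beta.
Notation Q := (dispatch net al be).
Notation pr := (price xi lam i).

(** Charging [c] at node [i] is extra demand there, billed at the local price. *)
Lemma dispatch_shift x c : x \in s -> `|c| < e ->
  Q (x + c *: delta_mx i 0) = (fine (Q x) + lam x i 0 * c)%:E.
Proof.
move=> xs ce; have [q Qaff] := Q_affine xs.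
have -> : fine (Q x) = q.
  by rewrite -[x in Q x]addr0 Qaff ?dot0r ?addr0// => j; rewrite mxE normr0.
rewrite Qaff ?dotZr ?dot_delta 1?mulrC// => j; rewrite !mxE andbT.
by case: (j == i); rewrite ?mulr1 ?mulr0 ?normr0.
Qed.

(** The optimal cost along one path: dispatch without storage, less the arbitrage profit of capacity
    [t]. *)
Definition bill (t : R) (w : T) : R :=
  \sum_(k < N) fine (Q (demand xi k w)) - t * gains N (pr w).

Lemma price_ext w w' k :
  (forall k, (k < N)%N -> demand xi k w = demand xi k w') ->
  (k < N)%N -> pr w k = pr w' k.
Proof. by move=> ww' kN; rewrite /price ww'. Qed.

Lemma causal_gains : causal xi N (gains N \o pr).
Proof.
move=> w w' ww' /=; apply: eq_bigr => k _.
have kN : (k.+1 < N)%N by rewrite -ltn_predRL.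
by rewrite !(price_ext ww')// ltnW.
Qed.

Lemma causal_bill t : causal xi N (bill t).
Proof.
move=> w w' ww'; rewrite /bill.
have /= -> := causal_gains ww'.
by congr (_ - _); apply: eq_bigr => k _; rewrite ww'.
Qed.

Lemma causal_policy_cost pi :
  causal xi N (fun w => \sum_(k < N) gcost al be (vcontrol xi pi k w)).
Proof.
move=> w w' ww'; apply: eq_bigr => k _; congr gcost.
by apply: vcontrol_ext => j jk; apply: ww'; exact: leq_ltn_trans jk (ltn_ord k).
Qed.

Lemma price_ge0 w k : (k < N)%N -> 0 <= pr w k.
Proof.
move=> kN; have /andP[b0 ba] := alpha_beta.
by rewrite /price; have [->|->] := lam_ab (xi_in w kN) => //; exact: le_trans ba.
Qed.

(** Each [vcontrol] is feasible for the dispatch of demand plus charge, whose cost is linear in the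
    charge, so the clairvoyant arbitrage bound applies pathwise. *)
Lemma Jpol_ge t pi : 0 <= t -> t < e ->
  admissible net N xi (t *: delta_mx i 0) pi ->
  ('E_P[bill t] <= Jpol al be N xi pi)%E.
Proof.
move=> t0 te adm; apply: (causal_le_ae xi_in); [exact: causal_bill|exact: causal_policy_cost|].
have /ae_foralln : forall k, {ae P, forall w, (k < N)%N ->
    storage_set (t *: delta_mx i 0) (storage xi pi k w + ucontrol xi pi k w) /\
    injection_polytope net (vcontrol xi pi k w - ucontrol xi pi k w - demand xi k w)}.
  move=> k; have [kN|kN] := boolP (k < N)%N; last by apply: nearW => w.
  by apply: filterS (adm k kN) => w.
apply: filterS => w H.
pose z k := storage xi pi k w i 0.
have zS k : (k < N)%N -> 0 <= z k.+1 <= t.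
  move=> /H[/(_ i) + _]; rewrite -storageS /z.
  by rewrite [in X in X -> _]mxE [in X in X -> _]mxE !eqxx mulr1.
have zB k : (k < N)%N -> 0 <= z k <= t.
  case: k => [|k] kN; last exact/zS/ltnW.
  by rewrite /z storage0 mxE lexx t0.
(* Nodes other than [i] have zero capacity, so they stay empty. *)
have z_other k j : j != i -> (k <= N)%N -> storage xi pi k w j 0 = 0.
  move=> ji; case: k => [|k] kN; first by rewrite storage0 mxE.
  have [/(_ j) + _] := H k kN; rewrite -storageS !mxE (negPf ji) mulr0.
  by rewrite -eq_le => /eqP.
have uE k : (k < N)%N -> ucontrol xi pi k w = (z k.+1 - z k) *: delta_mx i 0.
  move=> kN; have -> : ucontrol xi pi k w = storage xi pi k.+1 w - storage xi pi k w.
    by rewrite storageS addrC addKr.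
  apply/colP => j; rewrite !mxE andbT; have [->|ji] := eqVneq j i.
    by rewrite mulr1.
  by rewrite mulr0 !z_other ?subrr// ltnW.
have cost_ge (k : 'I_N) : fine (Q (demand xi k w)) + pr w k * (z k.+1 - z k)
    <= gcost al be (vcontrol xi pi k w).
  have kN := ltn_ord k.
  have small : `|z k.+1 - z k| < e.
    by have := zS k kN; have := zB k kN; rewrite ltr_norml; lra.
  rewrite -lee_fin -(dispatch_shift (xi_in w kN) small) -uE//.
  apply: ereal_inf_lbound; exists (vcontrol xi pi k w) => //=.
  by have [_] := H k kN; rewrite [demand _ _ _ + _]addrC opprD addrA.
apply: le_trans (ler_sum _ (fun k _ => cost_ge k)).
rewrite big_split /bill lerD2l; apply: arbitrage_ge => //.
- by rewrite /z storage0 mxE.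
- by move=> k; exact: price_ge0.
Qed.

(** The test [k < N.-1] empties the store in the last period, when no price increase remains. *)
Definition target (t : R) (k : nat) (x : 'cV[R]_m) : 'cV[R]_m :=
  (if (k < N.-1)%N && (lam x i 0 == beta) then t else 0) *: delta_mx i 0.

Definition near_optimal (eps : R) (x : 'cV[R]_m) : 'cV[R]_m :=
  get [set v | injection_polytope net (v - x) /\
               ((gcost al be v)%:E <= Q x + eps%:E)%E].

(** Subtracting the current stock makes the next stock equal the target whatever the past. *)
Definition threshold_policy (t eps : R) : policy R m :=
  let u k (zs xs : k.+1.-tuple 'cV[R]_m) :=
    target t k (tnth xs ord_max) - tnth zs ord_max in
  Policy u (fun k zs xs => near_optimal eps (tnth xs ord_max + u k zs xs)).

Lemma near_optimalP eps x : 0 < eps -> Q x \is a fin_num ->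
  injection_polytope net (near_optimal eps x - x) /\
  ((gcost al be (near_optimal eps x))%:E <= Q x + eps%:E)%E.
Proof.
move=> eps0 Qx; have [_ [v vP <-] /ltW vQ] := lb_ereal_inf_adherent eps0 Qx.
exact: (@getPex _ [set v | injection_polytope net (v - x) /\
  ((gcost al be v)%:E <= Q x + eps%:E)%E] (ex_intro _ v (conj vP vQ))).
Qed.

Lemma storage_threshold t eps k w :
  storage xi (threshold_policy t eps) k.+1 w = target t k (demand xi k w).
Proof.
by rewrite storageS /ucontrol /= tnth_demand_hist -/(storage _ _ _ _) addrC subrK.
Qed.

(** Each period costs at most [eps] more than the shifted dispatch, and the stocks collect the full
    arbitrage profit. *)
Lemma threshold_policyP t eps : 0 <= t -> t < e -> 0 < eps ->
  admissible net N xi (t *: delta_mx i 0) (threshold_policy t eps) /\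
  (forall w, \sum_(k < N) gcost al be (vcontrol xi (threshold_policy t eps) k w)
     <= bill t w + N%:R * eps).
Proof.
move=> t0 te eps0; set pi := threshold_policy t eps.
pose z w k : R := storage xi pi k w i 0.
have zS w k : z w k.+1 = if (k < N.-1)%N && (pr w k == beta) then t else 0.
  by rewrite /z storage_threshold !mxE !eqxx mulr1.
have zB w k : 0 <= z w k <= t.
  case: k => [|k]; first by rewrite /z storage0 mxE lexx t0.
  by rewrite zS; case: ifP => _; rewrite ?lexx t0.
have stE w k : storage xi pi k w = z w k *: delta_mx i 0.
  case: k => [|k]; first by rewrite /z storage0 mxE scale0r.
  by rewrite zS storage_threshold.
have uE w k : ucontrol xi pi k w = (z w k.+1 - z w k) *: delta_mx i 0.
  rewrite scalerBl -!stE storageS; set a := storage _ _ _ _.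
  by rewrite addrC addKr.
have small w k : `|z w k.+1 - z w k| < e.
  by have := zB w k.+1; have := zB w k; rewrite ltr_norml; lra.
have vE w k : vcontrol xi pi k w =
    near_optimal eps (demand xi k w + ucontrol xi pi k w).
  by rewrite /vcontrol /= tnth_demand_hist.
have QE w k : (k < N)%N -> Q (demand xi k w + ucontrol xi pi k w) =
    (fine (Q (demand xi k w)) + pr w k * (z w k.+1 - z w k))%:E.
  by move=> kN; rewrite uE (dispatch_shift (xi_in w kN)).
have vP w k (kN : (k < N)%N) :
    injection_polytope net (vcontrol xi pi k w - (demand xi k w + ucontrol xi pi k w)) /\
    ((gcost al be (vcontrol xi pi k w))%:E <=
       Q (demand xi k w + ucontrol xi pi k w) + eps%:E)%E.
  by rewrite vE; apply: near_optimalP => //; rewrite QE.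
split=> [k kN|w].
  apply: nearW => w; split; last first.
    by have [+ _] := vP w k kN; rewrite [demand _ _ _ + _]addrC opprD addrA.
  rewrite -storageS stE => j; rewrite !mxE.
  by case: (j == i); rewrite ?mulr0 ?mulr1 ?lexx//; exact: zB.
have le_cost (k : 'I_N) : gcost al be (vcontrol xi pi k w) <=
   fine (Q (demand xi k w)) + pr w k * (z w k.+1 - z w k) + eps.
  by have [_] := vP w k (ltn_ord k); rewrite QE// -EFinD lee_fin.
apply: le_trans (ler_sum _ (fun k _ => le_cost k)) _.
rewrite big_split /= sumr_const card_ord mulr_natl lerD2r.
rewrite big_split /bill lerD2l /=.
have /andP[_ ba] := alpha_beta.
rewrite (@arbitrage_eq _ alpha beta t)//.
- by rewrite /z storage0 mxE.
- by move=> k kN; exact: lam_ab (xi_in w kN).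
Qed.

Lemma JstarE t : 0 <= t -> t < e ->
  Jstar net al be N xi (t *: delta_mx i 0) = 'E_P[bill t]%E.
Proof.
move=> t0 te; apply/eqP; rewrite eq_le; apply/andP; split; last first.
  by apply/ereal_infP => _ [pi adm <-]; exact: Jpol_ge.
apply/lee_addgt0Pr => eps eps0.
(* An error of [eps / N] per period adds up to [eps]. *)
have eps'0 : 0 < eps / N%:R by rewrite divr_gt0 ?ltr0n.
have [adm cost] := threshold_policyP t0 te eps'0.
apply: ge_ereal_inf; exists (Jpol al be N xi (threshold_policy t (eps / N%:R))).
  by exists (threshold_policy t (eps / N%:R)).
rewrite -(expectation_cst P eps) -expectationD; last 2 first.
- by apply: (causal_Lfun xi_in); exact: causal_bill.
- exact: (causal_Lfun xi_in).
apply: (causal_le_ae xi_in).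
- exact: causal_policy_cost.
- by move=> w w' ww' /=; rewrite (causal_bill t ww').
apply: nearW => w /=; apply: le_trans (cost w) _.
by rewrite mulrC divfK // pnatr_eq0 -lt0n.
Qed.

Lemma bill_expectation t : ('E_P[bill t] = 'E_P[bill 0] - t%:E * 'E_P[gains N \o pr])%E.
Proof.
rewrite -expectationZl; last by apply: (causal_Lfun xi_in); exact: causal_gains.
rewrite -expectationB; last 2 first.
- by apply: (causal_Lfun xi_in); exact: causal_bill.
- by apply: (causal_Lfun xi_in) => w w' ww' /=; have /= -> := causal_gains ww'.
congr expectation; apply/funext => w /=.
by rewrite /bill mul0r subr0 mulrC.
Qed.

Lemma Jstar_quotient_cvg :
  Jstar_quotient net al be N xi i t @[t --> 0^'+] --> (- 'E_P[gains N \o pr])%E.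
Proof.
have fin f : causal xi N f -> exists r, 'E_P[f]%E = r%:E.
  move=> fN; exists (fine 'E_P[f]%E); rewrite fineK// expectation_fin_num//.
  exact: (causal_Lfun xi_in).
have [g gE] := fin _ causal_gains.
have [b bE] := fin _ (causal_bill 0).
(* The optimal cost is affine in [t] on [[0, e)], so the quotient is constant for [0 < t < e]. *)
apply: cvg_near_cst; near=> t.
have t0 : 0 < t by [].
have te : t < e by near: t; exact: nbhs_right_lt.
rewrite /Jstar_quotient JstarE// ?(ltW t0)//.
rewrite -(scale0r (delta_mx i 0)) JstarE// bill_expectation.
rewrite gE bE; congr EFin.
by field; exact: lt0r_neq0.
Unshelve. all: by end_near. Qed.

End MarginalValue.

Theorem proposition1 (R : realType) (m l : nat) (net : network R m l)
    (al be : 'I_m -> R)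
    (cost_ord : forall i, 0 <= be i <= al i)
    (d : measure_display) (T : measurableType d) (P : probability T R)
    (N : nat) (N_gt0 : (0 < N)%N)
    (xi : nat -> 'I_m -> {RV P >-> R})
    (Xi : set 'cV[R]_m)
    (xi_in : forall k w, (k < N)%N -> Xi (demand xi k w))
    (lam : 'cV[R]_m -> 'cV[R]_m)
    (lam_mult : forall x, is_multiplier net al be x (lam x))
    (K : set 'cV[R]_m) (p : nat) (S : 'I_p -> set 'cV[R]_m)
    (part : price_partition net al be lam Xi K S)
    (Xi_finite : finite_set Xi)
    (Xi_boundary : Xi `&` partition_boundary S = set0)
    (acyclic : acyclic_net net)
    (alpha beta : R) (alpha_beta : 0 <= beta <= alpha)
    (homogeneous : forall j, al j = alpha /\ be j = beta) :
  forall i : 'I_m,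
    [/\ forall x, Xi x -> lam x i 0 = alpha \/ lam x i 0 = beta,
        cvg (Jstar_quotient net al be N xi i t @[t --> 0^'+]),
        LMV net al be N xi i =
          ((2^-1)%:E * 'E_P[fun w => seq_TV N (price xi lam i w)] +
           (2^-1)%:E * 'E_P[fun w => (price xi lam i w N.-1 - price xi lam i w 0%N)%R])%E &
        LMV net al be N xi i =
          ((alpha - beta)%:E *
           'E_P[fun w => ((upcrossings alpha beta N (price xi lam i w))%:R)%R])%E ].
Proof.
move=> i.
have [e e0 aff] := finite_locally_affine Xi_finite
  (fun x => partition_locally_affine part Xi_boundary (x := x)).
have /andP[b0 ba] := alpha_beta.
have lam_ab x : Xi x -> lam x i 0 = alpha \/ lam x i 0 = beta.
  move=> Xix.
  exact: acyclic_price_extreme acyclic b0 homogeneous (lam_mult x) e0 (aff x Xix).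
have [s XiE] := iffLR (finite_seqP Xi) Xi_finite.
have inE' x : x \in s -> Xi x by rewrite XiE.
have xi_s k w : (k < N)%N -> demand xi k w \in s.
  by move=> kN; have := xi_in k w kN; rewrite XiE.
have quot := Jstar_quotient_cvg N_gt0 xi_s e0
  (fun x xs => aff x (inE' x xs)) alpha_beta (fun x xs => lam_ab x (inE' x xs)).
have LMVE : LMV net al be N xi i = 'E_P[gains N \o price xi lam i]%E.
  by rewrite /LMV (cvg_lim _ quot)// oppeK.
have pr_ab w k : (k < N)%N -> price xi lam i w k = alpha \/ price xi lam i w k = beta.
  by move=> kN; exact/lam_ab/xi_in.
split => //; first by apply/cvg_ex; eexists; exact: quot.
(* Linearity of expectation reduces the identity to [TV_gains] on each price path. *)
- rewrite LMVE -!expectationZl; last 2 first.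
  + apply: (causal_Lfun xi_s) => w w' ww'.
    by rewrite !(price_ext _ _ ww')// ?ltn_predL.
  + apply: (causal_Lfun xi_s) => w w' ww'; apply: eq_big_nat => k /andP[_ kN].
    have kN' : (k.+1 < N)%N by rewrite -ltn_predRL.
    by rewrite !(price_ext _ _ ww')// ltnW.
  rewrite -expectationD; last 2 first.
  + apply: (causal_Lfun xi_s) => w w' ww' /=; congr (_ * _); apply: eq_big_nat => k /andP[_ kN].
    have kN' : (k.+1 < N)%N by rewrite -ltn_predRL.
    by rewrite !(price_ext _ _ ww')// ltnW.
  + apply: (causal_Lfun xi_s) => w w' ww' /=.
    by rewrite !(price_ext _ _ ww')// ?ltn_predL.
  by congr expectation; apply/funext => w /=; rewrite -TV_gains ![2^-1 * _]mulrC.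
- rewrite LMVE -expectationZl; last first.
    apply: (causal_Lfun xi_s) => w w' ww'; congr (_%:R); apply: eq_in_count => k.
    rewrite mem_iota add0n /= => kN; have kN' : (k.+1 < N)%N by rewrite -ltn_predRL.
    by rewrite !(price_ext _ _ ww')// ltnW.
  by congr expectation; apply/funext => w /=; rewrite -(upcrossings_gains ba (pr_ab w)) mulrC.
Qed.
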